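(* Let $M$ and $N$ be two pointed metric spaces with base points $0_M$ and $0_N$, and let $f:M\to N$ be a Lipschitz map such that $f(0_M)=0_N$. Then the range of $\widehat{f}:\mathcal{F}(M)\to\mathcal{F}(N)$ is dense in $\mathcal{F}(N)$ if and only if the range of $f$ is dense in $N$.
   Context: For a metric space $(M,d)$ with base point $0_M$, $\mathrm{Lip}_0(M)$ is the real Banach space of Lipschitz functions $M\to\mathbb{R}$ vanishing at $0_M$, with norm the best Lipschitz constant. For $x\in M$, $\delta_M(x)\in \mathrm{Lip}_0(M)^*$ is the evaluation $\langle \varphi,\delta_M(x)\rangle=\varphi(x)$. The Lipschitz-free space is $\mathcal{F}(M)=\overline{\mathrm{span}}^{\|\cdot\|}\{\delta_M(x):x\in M\}\subset \mathrm{Lip}_0(M)^*$. If $f:M\to N$ is Lipschitz with $f(0_M)=0_N$, $\widehat{f}:\mathcal{F}(M)\to\mathcal{F}(N)$ is the unique bounded linear operator with $\widehat{f}(\delta_M(x))=\delta_N(f(x))$ for all $x\in M$. *)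

(* Defs.v *)
From HB Require Import structures.
From mathcomp Require Import all_boot all_order all_algebra.
From mathcomp Require Import all_classical all_reals all_analysis.

Set Implicit Arguments.
Unset Strict Implicit.
Unset Printing Implicit Defensive.

Import Order.TTheory GRing.Theory Num.Theory.
Import numFieldNormedType.Exports.

Local Open Scope classical_set_scope.
Local Open Scope ring_scope.

(* The library's [lipschitz] only covers maps between normed modules. *)
Section lipschitz_maps.
Context {R : realType} {T U : metricType R}.

Definition lipschitz_constants (f : T -> U) : set R :=
  [set k | 0 <= k /\ forall x y, mdist (f x) (f y) <= k * mdist x y].

Definition lipschitz_map (f : T -> U) : Prop := lipschitz_constants f !=set0.

Definition best_lipschitz_constant (f : T -> U) : R :=
  inf (lipschitz_constants f).

Lemma has_inf_lipschitz_constants f :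
  lipschitz_map f -> has_inf (lipschitz_constants f).
Proof. by move=> f_lip; split=> //; exists 0 => k []. Qed.

Lemma best_lipschitz_constantP f :
  lipschitz_map f -> lipschitz_constants f (best_lipschitz_constant f).
Proof.
move=> f_lip; have hinf := has_inf_lipschitz_constants f_lip.
split; first by apply: lb_le_inf => // k [].
move=> x y; have [->|xy] := eqVneq x y; first by rewrite !mdistxx mulr0.
rewrite -ler_pdivrMr ?mdist_gt0//; apply: lb_le_inf => // k [k0 fk].
by rewrite ler_pdivrMr ?mdist_gt0.
Qed.

Lemma best_lipschitz_constant_le f k :
  lipschitz_constants f k -> best_lipschitz_constant f <= k.
Proof. by move=> fk; apply: ge_inf => //; exists 0 => ? []. Qed.

End lipschitz_maps.

Section lip0.
Context {R : realType} {M : metricType R} (o : M).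

Definition lip0_pred : {pred M -> R^o} :=
  mem [set phi : M -> R^o | phi o = 0 /\ lipschitz_map phi].

Record lip0 := Lip0 { lip0_fun :> M -> R^o ; _ : lip0_fun \in lip0_pred }.

HB.instance Definition _ := [isSub for lip0_fun].
HB.instance Definition _ := [Choice of lip0 by <:].

Lemma lipschitz_constantsD (a : R) (f g : M -> R^o) k l :
  lipschitz_constants f k -> lipschitz_constants g l ->
  lipschitz_constants (a *: f + g) (`|a| * k + l).
Proof.
move=> [k0 fk] [l0 gl]; split; first by rewrite addr_ge0// mulr_ge0.
move=> x y; have {fk gl}:= (fk x y, gl x y).
rewrite /mdist/= => -[fk gl].
have -> : (a *: f + g) y - (a *: f + g) x = a * (f y - f x) + (g y - g x).
  by rewrite mulrBr opprD addrACA.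
rewrite (le_trans (ler_normD _ _))// normrM mulrDl lerD// -mulrA.
by rewrite ler_wpM2l.
Qed.

Lemma lip0_submod_closed : submod_closed lip0_pred.
Proof.
split.
  rewrite inE; split=> //; exists 0; split=> // x y.
  by rewrite /mdist/= subrr normr0 mul0r.
move=> a f g; rewrite !inE => -[f0 [k fk]] [g0 [l gl]]; split.
  by rewrite /GRing.add/= /GRing.scale/= f0 g0 scaler0 addr0.
by exists (`|a| * k + l); exact: lipschitz_constantsD.
Qed.

HB.instance Definition _ :=
  GRing.isSubmodClosed.Build R (M -> R^o) lip0_pred lip0_submod_closed.
HB.instance Definition _ := [SubChoice_isSubLmodule of lip0 by <:].

Lemma lip0_base (phi : lip0) : phi o = 0.
Proof. by case: phi => f /=; rewrite inE => -[]. Qed.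

Lemma lip0_lipschitz (phi : lip0) : lipschitz_map phi.
Proof. by case: phi => f /=; rewrite inE => -[]. Qed.

Definition lip0_norm (phi : lip0) : R := best_lipschitz_constant phi.

Lemma lip0_normP (phi : lip0) : lipschitz_constants phi (lip0_norm phi).
Proof. exact/best_lipschitz_constantP/lip0_lipschitz. Qed.

Lemma lip0_ler_normD phi psi :
  lip0_norm (phi + psi) <= lip0_norm phi + lip0_norm psi.
Proof.
apply: best_lipschitz_constant_le.
have := lipschitz_constantsD 1 (lip0_normP phi) (lip0_normP psi).
by rewrite normr1 mul1r scale1r.
Qed.

Lemma lip0_norm0 : lip0_norm 0 = 0.
Proof.
apply/eqP; rewrite eq_le (proj1 (lip0_normP _)) andbT.
apply: best_lipschitz_constant_le; split=> // x y.
by rewrite /mdist/= subrr normr0 mul0r.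
Qed.

Lemma lip0_normrZ (a : R) phi : lip0_norm (a *: phi) = `|a| * lip0_norm phi.
Proof.
have normZ b psi : lip0_norm (b *: psi) <= `|b| * lip0_norm psi.
  apply: best_lipschitz_constant_le.
  have := lipschitz_constantsD b (lip0_normP psi) (lip0_normP 0).
  by rewrite lip0_norm0 !addr0.
apply/eqP; rewrite eq_le normZ /=.
have [->|a0] := eqVneq a 0.
  by rewrite normr0 mul0r (proj1 (lip0_normP _)).
rewrite -ler_pdivlMl ?normr_gt0// -normfV.
by apply: le_trans (normZ _ _); rewrite scalerA mulVf// scale1r.
Qed.

Lemma lip0_norm_eq0 phi : lip0_norm phi = 0 -> phi = 0.
Proof.
move=> phi0; apply/val_inj/funext => x /=.
have [_ /(_ o x)] := lip0_normP phi.
by rewrite phi0 mul0r /mdist/= lip0_base subr0 normr_le0 => /eqP.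
Qed.

HB.instance Definition _ := Lmodule_isNormed.Build R lip0
  lip0_ler_normD lip0_normrZ lip0_norm_eq0.

Lemma lip0_le_norm (phi : lip0) x y : `|phi y - phi x| <= `|phi| * mdist x y.
Proof. exact: (proj2 (lip0_normP phi)). Qed.

End lip0.

Arguments lip0_pred {R M} o.
Arguments lip0 {R M} o.

Lemma bounded_op_continuous {R : realType} (V W : normedModType R)
    (g : V -> W) k :
  linear g -> (forall v, `|g v| <= k * `|v|) -> continuous g.
Proof.
move=> gl gk.
pose G : {linear V -> W} := HB.pack g (GRing.isLinear.Build _ _ _ _ g gl).
apply: (@bounded_linear_continuous _ _ _ G); apply/linear_boundedP.
apply: filterS (nbhs_pinfty_ge (num_real k)) => r kr v.
by apply: (le_trans (gk v)); rewrite ler_wpM2r.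
Qed.

Section dual.
Context {R : realType} (V : normedModType R).

Definition dual_pred : {pred V -> R^o} :=
  mem [set u : V -> R^o | linear u /\ continuous u].

Record dual := Dual { dual_fun :> V -> R^o ; _ : dual_fun \in dual_pred }.

HB.instance Definition _ := [isSub for dual_fun].
HB.instance Definition _ := [Choice of dual by <:].

Lemma dual_submod_closed : submod_closed dual_pred.
Proof.
split.
  rewrite inE; split; first by move=> a u v; rewrite scaler0 addr0.
  by move=> x; exact: (@cvg_cst R^o).
move=> a f g; rewrite !inE => -[fl fc] [gl gc]; split.
  move=> b u v.
  rewrite -[LHS]/(a *: f (b *: u + v) + g (b *: u + v)).
  rewrite -[RHS]/(b *: (a *: f u + g u) + (a *: f v + g v)).
  by rewrite fl gl !scalerDr !scalerA (mulrC a b) addrACA.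
move=> x; apply: (@continuousD _ R^o); last exact: gc.
by apply: (@continuousZr _ R^o); exact: fc.
Qed.

HB.instance Definition _ :=
  GRing.isSubmodClosed.Build R (V -> R^o) dual_pred dual_submod_closed.
HB.instance Definition _ := [SubChoice_isSubLmodule of dual by <:].

Lemma dual_linear (u : dual) : linear u.
Proof. by case: u => f /=; rewrite inE => -[]. Qed.

HB.instance Definition _ (u : dual) :=
  GRing.isLinear.Build R V R^o _ u (dual_linear u).

Lemma dual_continuous (u : dual) : continuous u.
Proof. by case: u => f /=; rewrite inE => -[]. Qed.

Definition dual_norm (u : dual) : R :=
  sup [set `|u v| | v in [set v : V | `|v| <= 1]].

Lemma has_sup_dual_norm (u : dual) :
  has_sup [set `|u v| | v in [set v : V | `|v| <= 1]].
Proof.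
split; first by exists `|u 0|; exists 0 => //=; rewrite normr0.
have /linear_boundedP/pinfty_ex_gt0[k k0 uk] :=
  (linear_bounded_continuous u).2 (@dual_continuous u).
exists k => _ [v /= v1 <-]; apply: (le_trans (uk v)).
by rewrite ler_piMr// ltW.
Qed.

Lemma dual_norm_ge0 u : 0 <= dual_norm u.
Proof.
apply: le_trans (normr_ge0 (u 0)) _.
by apply: (sup_upper_bound (has_sup_dual_norm u)); exists 0; rewrite //= normr0.
Qed.

Lemma dual_le_norm' (u : dual) v : `|u v| <= dual_norm u * `|v|.
Proof.
have [->|v0] := eqVneq v 0; first by rewrite linear0 !normr0 mulr0.
have nv : 0 < `|v| by rewrite normr_gt0.
rewrite -ler_pdivrMr// mulrC.
have -> : `|v|^-1 * `|u v| = `|u (`|v|^-1 *: v)|.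
  by rewrite linearZ/= normrM ger0_norm// invr_ge0.
apply: (sup_upper_bound (has_sup_dual_norm u)); exists (`|v|^-1 *: v) => //=.
by rewrite normrZ normfV normr_id mulVf// gt_eqF.
Qed.

Lemma dual_norm_le' (u : dual) k :
  0 <= k -> (forall v, `|u v| <= k * `|v|) -> dual_norm u <= k.
Proof.
move=> k0 uk; apply: ge_sup; first exact: (has_sup_dual_norm u).1.
by move=> _ [v /= v1 <-]; apply: (le_trans (uk v)); rewrite ler_piMr.
Qed.

Lemma dual_ler_normD u v : dual_norm (u + v) <= dual_norm u + dual_norm v.
Proof.
apply: dual_norm_le'; first by rewrite addr_ge0// dual_norm_ge0.
move=> x; rewrite mulrDl (le_trans (ler_normD _ _))// lerD//;
  exact: dual_le_norm'.
Qed.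

Lemma dual_normrZ (a : R) u : dual_norm (a *: u) = `|a| * dual_norm u.
Proof.
have normZ b w : dual_norm (b *: w) <= `|b| * dual_norm w.
  apply: dual_norm_le'; first by rewrite mulr_ge0// dual_norm_ge0.
  by move=> x; rewrite [X in X <= _]normrM -mulrA ler_wpM2l// dual_le_norm'.
apply/eqP; rewrite eq_le normZ /=.
have [->|a0] := eqVneq a 0; first by rewrite normr0 mul0r dual_norm_ge0.
rewrite -ler_pdivlMl ?normr_gt0// -normfV.
by apply: le_trans (normZ _ _); rewrite scalerA mulVf// scale1r.
Qed.

Lemma dual_norm_eq0 u : dual_norm u = 0 -> u = 0.
Proof.
move=> u0; apply/val_inj/funext => x /=; apply/eqP.
by rewrite -normr_le0 (le_trans (dual_le_norm' _ _))// u0 mul0r.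
Qed.

HB.instance Definition _ := Lmodule_isNormed.Build R dual
  dual_ler_normD dual_normrZ dual_norm_eq0.

Lemma dual_le_norm (u : dual) v : `|u v| <= `|u| * `|v|.
Proof. exact: dual_le_norm'. Qed.

Lemma dual_norm_le (u : dual) k :
  0 <= k -> (forall v, `|u v| <= k * `|v|) -> `|u| <= k.
Proof. exact: dual_norm_le'. Qed.

End dual.

Arguments dual_pred {R} V.

Section closed_span.
Context {R : realType} {V : normedModType R} (A : set V).

Definition lin_span : set V :=
  [set v | exists n (a : 'I_n -> R) (x : 'I_n -> V),
     (forall i, A (x i)) /\ v = \sum_(i < n) a i *: x i].

Definition closed_span_pred : {pred V} := mem (closure lin_span).

Record closed_span :=
  ClosedSpan { closed_span_val : V ; _ : closed_span_val \in closed_span_pred }.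

HB.instance Definition _ := [isSub for closed_span_val].
HB.instance Definition _ := [Choice of closed_span by <:].

Lemma lin_span0 : lin_span 0.
Proof.
exists 0, (fun=> 0), (fun=> 0); split; first by case.
by rewrite big_ord0.
Qed.

Lemma lin_span_linear (c : R) u v :
  lin_span u -> lin_span v -> lin_span (c *: u + v).
Proof.
move=> [n [a [x [Ax ->]]]] [m [b [y [Ay ->]]]].
exists (n + m)%N,
  (fun i : 'I_(n + m) => match fintype.split i with inl j => c * a j | inr j => b j end),
  (fun i : 'I_(n + m) => match fintype.split i with inl j => x j | inr j => y j end).
split; first by move=> i; case: fintype.split.
rewrite big_split_ord/= scaler_sumr; congr (_ + _); apply: eq_bigr => i _.
  by rewrite -[lshift m i]/(unsplit (inl i)) unsplitK scalerA.
by rewrite -[rshift n i]/(unsplit (inr i)) unsplitK.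
Qed.

Lemma closure_normP (S : set V) v :
  closure S v <-> forall e, 0 < e -> exists2 w, S w & `|v - w| < e.
Proof.
split=> [Sv e e0|Sv B /nbhs_normP[e /= e0 Be]].
  by have [w [Sw /= vw]] := Sv _ (nbhsx_ballx v e e0); exists w => //;
    move: vw; rewrite -ball_normE.
by have [w Sw vw] := Sv e e0; exists w; split=> //; exact: Be.
Qed.

Lemma closed_span_submod_closed : submod_closed closed_span_pred.
Proof.
split; first by rewrite inE; apply: subset_closure; exact: lin_span0.
move=> c u v; rewrite !inE => /closure_normP su /closure_normP sv.
apply/closure_normP => e e0.
have c1 : 0 < `|c| + 1 by rewrite ltr_wpDl.
have [u' su' uu'] := su (e / 2 / (`|c| + 1)) ltac:(by rewrite !divr_gt0).
have [v' sv' vv'] := sv (e / 2) ltac:(by rewrite divr_gt0).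
exists (c *: u' + v'); first exact: lin_span_linear.
rewrite opprD addrACA -scalerBr (le_lt_trans (ler_normD _ _))//.
rewrite [ltRHS]splitr ler_ltD// normrZ.
rewrite ltr_pdivlMr// in uu'; apply: le_trans (ltW uu').
by rewrite mulrC ler_wpM2l// lerDl.
Qed.

HB.instance Definition _ :=
  GRing.isSubmodClosed.Build R V closed_span_pred closed_span_submod_closed.
HB.instance Definition _ := [SubChoice_isSubLmodule of closed_span by <:].

Definition closed_span_norm (u : closed_span) : R := `|val u|.

Lemma closed_span_ler_normD u v :
  closed_span_norm (u + v) <= closed_span_norm u + closed_span_norm v.
Proof. exact: ler_normD. Qed.

Lemma closed_span_normrZ (a : R) u :
  closed_span_norm (a *: u) = `|a| * closed_span_norm u.
Proof. exact: normrZ. Qed.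

Lemma closed_span_norm_eq0 u : closed_span_norm u = 0 -> u = 0.
Proof. by move=> /eqP; rewrite normr_eq0 => /eqP u0; exact: val_inj. Qed.

HB.instance Definition _ := Lmodule_isNormed.Build R closed_span
  closed_span_ler_normD closed_span_normrZ closed_span_norm_eq0.

Lemma closed_span_normE (u : closed_span) : `|u| = `|val u|.
Proof. by []. Qed.

Lemma closed_spanP (u : closed_span) : closure lin_span (val u).
Proof. by case: u => v /=; rewrite inE. Qed.

Lemma sub_closed_span v : A v -> v \in closed_span_pred.
Proof.
move=> Av; rewrite inE; apply: subset_closure.
by exists 1%N, (fun=> 1), (fun=> v); rewrite big_ord1 scale1r.
Qed.

End closed_span.

Arguments closed_span_pred {R V} A.
Arguments closed_spanP {R V A} u.

Section lipfree.
Context {R : realType} {M : metricType R} (o : M).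

Definition delta_fun (x : M) : lip0 o -> R^o := fun phi => phi x.

Lemma delta_fun_linear x : linear (delta_fun x).
Proof. by []. Qed.

Lemma delta_subproof x : delta_fun x \in dual_pred (lip0 o).
Proof.
rewrite inE; split; first exact: delta_fun_linear.
apply: (bounded_op_continuous (delta_fun_linear x) (k := mdist o x)) => phi.
by have := lip0_le_norm phi o x; rewrite lip0_base subr0 mulrC.
Qed.

Definition delta (x : M) : dual (lip0 o) := Dual (delta_subproof x).

Definition lipfree := closed_span (range delta).

HB.instance Definition _ := NormedModule.on lipfree.

Definition free_delta (x : M) : lipfree :=
  ClosedSpan (sub_closed_span (imageT delta x)).

End lipfree.

Lemma lipfree_approx {R : realType} {M : metricType R} (o : M)
    (u : lipfree o) (e : R) : 0 < e ->
  exists n (a : 'I_n -> R) (x : 'I_n -> M),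
    `|u - \sum_(i < n) a i *: free_delta o (x i)| < e.
Proof.
move=> e0; have /closure_normP/(_ e e0) := closed_spanP u.
move=> [_ [n [a [v [vM ->]]]] uv].
have [x xv] : {x : 'I_n -> M & forall i, delta o (x i) = v i}.
  by apply: (@choice _ _ (fun i y => delta o y = v i)) => i; have [y _ <-] := vM i; exists y.
exists n, a, x; rewrite closed_span_normE raddfB raddf_sum/=.
by under eq_bigr do rewrite xv.
Qed.

Arguments lipfree {R M} o.
Arguments delta {R M o} x.
Arguments free_delta {R M o} x.

Section lipfree_map.
Context {R : realType} {M N : metricType R} {oM : M} {oN : N}.

(* For linear maps between normed modules, continuity is boundedness
   ([linear_bounded_continuous]). *)
Definition is_lipfree_map (f : M -> N) (g : lipfree oM -> lipfree oN) : Prop :=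
  [/\ linear g, continuous g & forall x, g (free_delta x) = free_delta (f x)].

Variables (f : M -> N) (f_lip : lipschitz_map f) (f0 : f oM = oN).

Let L := best_lipschitz_constant f.

Let L_ge0 : 0 <= L.
Proof. exact: (best_lipschitz_constantP f_lip).1. Qed.

Let fL x y : mdist (f x) (f y) <= L * mdist x y.
Proof. exact: (best_lipschitz_constantP f_lip).2. Qed.

Let pull_constants (phi : lip0 oN) :
  lipschitz_constants (phi \o f : M -> R^o) (L * `|phi|).
Proof.
split; first by rewrite mulr_ge0.
move=> x y; apply: (le_trans (lip0_le_norm phi (f x) (f y))).
by rewrite (mulrC L) -mulrA ler_wpM2l.
Qed.

Let pull_subproof (phi : lip0 oN) : (phi \o f : M -> R^o) \in lip0_pred oM.
Proof.
rewrite inE; split; first by rewrite /= f0 lip0_base.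
by exists (L * `|phi|); exact: pull_constants.
Qed.

Let pull (phi : lip0 oN) : lip0 oM := Lip0 (pull_subproof phi).

Let pull_norm phi : `|pull phi| <= L * `|phi|.
Proof. exact/best_lipschitz_constant_le/pull_constants. Qed.

Let pull_linear : linear pull.
Proof. by move=> a phi psi; exact: val_inj. Qed.

Let push_bound (u : dual (lip0 oM)) phi : `|u (pull phi)| <= `|u| * L * `|phi|.
Proof.
by apply: (le_trans (dual_le_norm u _)); rewrite -mulrA ler_wpM2l.
Qed.

Let push_subproof (u : dual (lip0 oM)) :
  (u \o pull : lip0 oN -> R^o) \in dual_pred (lip0 oN).
Proof.
have ul : linear (u \o pull : lip0 oN -> R^o).
  by move=> a phi psi; rewrite /= pull_linear linearP.
rewrite inE; split=> //.
exact: (bounded_op_continuous ul (push_bound u)).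
Qed.

Let push (u : dual (lip0 oM)) : dual (lip0 oN) := Dual (push_subproof u).

Let push_linear : linear push.
Proof. by move=> a u v; exact: val_inj. Qed.

Let push_norm u : `|push u| <= L * `|u|.
Proof.
apply: dual_norm_le => [|phi]; first by rewrite mulr_ge0.
by rewrite (mulrC L); exact: push_bound.
Qed.

Let push_delta x : push (delta x) = delta (f x).
Proof. exact: val_inj. Qed.

Let push_span u : lin_span (range delta) u -> lin_span (range delta) (push u).
Proof.
pose P : {linear _ -> _} :=
  HB.pack push (GRing.isLinear.Build _ _ _ _ push push_linear).
move=> [n [a [x [Ax ->]]]]; exists n, a, (push \o x); split.
  by move=> i /=; have [y _ <-] := Ax i; exists (f y); rewrite ?push_delta.
rewrite -[push]/(P : _ -> _) linear_sum; apply: eq_bigr => i _.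
by rewrite linearZ.
Qed.

Let push_closed (u : lipfree oM) :
  push (val u) \in closed_span_pred (range (@delta R N oN)).
Proof.
rewrite inE; apply/closure_normP => e e0.
have L1 : 0 < L + 1 by rewrite ltr_wpDl.
have /closure_normP su := closed_spanP u.
have [w sw uw] := su (e / (L + 1)) ltac:(by rewrite divr_gt0).
exists (push w); first exact: push_span.
have -> : push (val u) - push w = push (val u - w).
  by rewrite addrC -scaleN1r -push_linear scaleN1r addrC.
apply: (le_lt_trans (push_norm _)).
rewrite ltr_pdivlMr// in uw; apply: le_lt_trans uw.
by rewrite mulrC ler_wpM2l// lerDl.
Qed.

Lemma lipfree_map_exists : exists g, is_lipfree_map f g.
Proof.
exists (fun u => ClosedSpan (push_closed u)).
have gl : linear (fun u => ClosedSpan (push_closed u)).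
  by move=> a u v; apply: val_inj; exact: push_linear.
split=> //; last by move=> x; apply: val_inj; exact: push_delta.
by apply: (bounded_op_continuous gl (k := L)) => u; exact: push_norm.
Qed.

Lemma lipfree_map_unique g h :
  is_lipfree_map f g -> is_lipfree_map f h -> g = h.
Proof.
move=> [gl gc gd] [hl hc hd]; apply/funext => u.
pose G : {linear _ -> _} := HB.pack g (GRing.isLinear.Build _ _ _ _ g gl).
pose H : {linear _ -> _} := HB.pack h (GRing.isLinear.Build _ _ _ _ h hl).
have /linear_boundedP/pinfty_ex_gt0[k k0 gk] :=
  (linear_bounded_continuous G).2 gc.
have /linear_boundedP/pinfty_ex_gt0[l l0 hl'] :=
  (linear_bounded_continuous H).2 hc.
apply/eqP; rewrite -subr_eq0 -normr_le0; apply/ler_addgt0Pl => e e0; rewrite addr0.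
have kl : 0 < k + l by rewrite addr_gt0.
have [n [a [x ux]]] := lipfree_approx u (divr_gt0 e0 kl).
set w := (\sum_(i < n) _) in ux.
have GH : G w = H w.
  rewrite !linear_sum; apply: eq_bigr => i _; rewrite !linearZ.
  by congr (_ *: _); exact: etrans (gd _) (esym (hd _)).
have -> : g u - h u = G (u - w) - H (u - w).
  by rewrite (linearB G) (linearB H) GH opprB addrA subrK.
rewrite (le_trans (ler_normB _ _))// (le_trans (lerD (gk _) (hl' _)))//.
by rewrite -mulrDl mulrC -ler_pdivlMr// ltW.
Qed.

(* Characterized by [lipfree_mapP] and [lipfree_map_unique]; the choice made by
   [cid] is irrelevant. *)
Definition lipfree_map : lipfree oM -> lipfree oN :=
  projT1 (cid lipfree_map_exists).

Lemma lipfree_mapP : is_lipfree_map f lipfree_map.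
Proof. exact: projT2 (cid lipfree_map_exists). Qed.

End lipfree_map.

(* Main.v *)
(** If [f] misses the ball of radius [r] around [y], the tent function
    [z |-> max (0, r - d(y, z))] belongs to [Lip_0(N)], vanishes on the range of
    [f], hence is annihilated by the range of the operator induced by [f], but
    takes the value [r] at [y]. Conversely, [x |-> delta x] is 1-Lipschitz, so
    if [f] has dense range, every combination of evaluations at points of [N]
    is approximated by one of evaluations at points of the range of [f]. *)
From HB Require Import structures.
Require Import Defs.
From mathcomp Require Import all_boot all_order all_algebra.
From mathcomp Require Import all_classical all_reals all_analysis.
From mathcomp Require Import lra.

Import Order.TTheory GRing.Theory Num.Theory.
Import numFieldNormedType.Exports.

Local Open Scope classical_set_scope.
Local Open Scope ring_scope.

Lemma dense_closureP (T : topologicalType) (S : set T) :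
  dense S <-> forall x, closure S x.
Proof.
split=> [Sd x B /nbhs_interior Bx|Sd O [x Ox] Oo].
  have [||y [/interior_subset By Sy]] := Sd B°; last by exists y.
    by exists x; exact: nbhs_singleton.
  exact: open_interior.
by rewrite setIC; apply: (Sd x); exact: open_nbhs_nbhs.
Qed.

Lemma closure_mdistP {R : realType} {M : metricType R} (S : set M) x :
  closure S x <-> forall e, 0 < e -> exists2 y, S y & mdist x y < e.
Proof.
split=> [Sx e e0|Sx B /nbhs_ballP[e /= e0 Be]].
  have [y [Sy xy]] := Sx _ (nbhsx_ballx x e e0).
  by exists y => //; move: xy; rewrite ballEmdist.
by have [y Sy xy] := Sx e e0; exists y; split=> //; apply: Be; rewrite ballEmdist.
Qed.

Definition tent {R : realType} {M : metricType R} (y : M) (r : R) : M -> R^o :=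
  fun z => Num.max 0 (r - mdist y z).

Lemma tent_lipschitz {R : realType} {M : metricType R} (y : M) (r : R) :
  lipschitz_constants (tent y r) 1.
Proof.
split=> // x z; rewrite mul1r.
rewrite -[leLHS]/(`|Num.max 0 (r - mdist y z) - Num.max 0 (r - mdist y x) : R|).
(* With the triangle inequality used in both directions, each sign case of the two maxima is linear
   arithmetic. *)
have := metric_triangle y z x; have := metric_triangle y x z.
rewrite (metric_sym z x) => hz hx.
rewrite ler_norml; case: (leP 0 (r - mdist y z)) => ?;
  by case: (leP 0 (r - mdist y x)) => ?; apply/andP; split; lra.
Qed.

(** Pairing the difference with [phi] gives [phi x - phi y], which the Lipschitz bound of [phi]
    controls. *)
Lemma free_delta_le {R : realType} {M : metricType R} (o x y : M) :
  `|free_delta x - free_delta y : lipfree o| <= mdist x y.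
Proof.
rewrite closed_span_normE; apply: dual_norm_le => [|phi]; first exact: mdist_ge0.
rewrite metric_sym mulrC; exact: (lip0_le_norm phi y x).
Qed.

Section lipfree_map_range.
Context {R : realType} {M N : metricType R} {oM : M} {oN : N}.
Context {f : M -> N} {g : lipfree oM -> lipfree oN} (gf : is_lipfree_map f g).

Lemma is_lipfree_map_sum n (a : 'I_n -> R) (x : 'I_n -> M) :
  g (\sum_(i < n) a i *: free_delta (x i)) =
  \sum_(i < n) a i *: free_delta (f (x i)).
Proof.
have [gl _ gd] := gf.
pose G : {linear _ -> _} := HB.pack g (GRing.isLinear.Build _ _ _ _ g gl).
rewrite -[g]/(G : _ -> _) linear_sum; apply: eq_bigr => i _.
by rewrite linearZ; congr (_ *: _); exact: gd.
Qed.

(** On a finite combination of evaluations the pairing is a combination of the values [phi (f x)],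
    hence zero; boundedness of [g] carries this to the limit [u]. *)
Lemma is_lipfree_map_annihilated (phi : lip0 oN) :
  (forall x, phi (f x) = 0) -> forall u, val (g u) phi = 0.
Proof.
move=> phif u; have [gl gc _] := gf.
pose G : {linear _ -> _} := HB.pack g (GRing.isLinear.Build _ _ _ _ g gl).
have /linear_boundedP/pinfty_ex_gt0[k k0 gk] :=
  (linear_bounded_continuous G).2 gc.
apply/eqP; rewrite -normr_le0; apply/ler_addgt0Pl => e e0; rewrite addr0.
(* The error is at most [k * |u - w| * |phi|]; the added 1 keeps the divisor positive when [phi] is
   zero. *)
have c0 : 0 < k * (`|phi| + 1) by rewrite mulr_gt0// ltr_wpDl.
have [n [a [x ux]]] := lipfree_approx u (divr_gt0 e0 c0).
set w := (\sum_(i < n) _) in ux.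
have w0 : val (g w) phi = 0.
  rewrite is_lipfree_map_sum raddf_sum/=.
  (* Evaluation at [phi] is packed as a linear map so that it passes through the sum. *)
  pose ev (v : dual (lip0 oN)) : R^o := v phi.
  have evl : linear ev by [].
  pose E : {linear _ -> R^o} := HB.pack ev (GRing.isLinear.Build _ _ _ _ ev evl).
  rewrite -[LHS]/(E _) linear_sum big1// => i _.
  rewrite linearZ -[E _]/(phi (f (x i))) phif; exact: scaler0.
have -> : val (g u) phi = val (G (u - w)) phi.
  by rewrite (linearB G) -[RHS]/(val (g u) phi - val (g w) phi) w0 subr0.
apply: (le_trans (dual_le_norm _ _)).
apply: (@le_trans _ _ (k * `|u - w| * (`|phi| + 1))).
  by rewrite ler_pM//; [exact: gk|rewrite lerDl].
by rewrite mulrAC mulrC -ler_pdivlMr// ltW.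
Qed.

Lemma dense_range_lipfree_map : dense (range f) -> dense (range g).
Proof.
move=> /dense_closureP df; apply/dense_closureP => v.
apply/closure_normP => e e0.
have [n [a [y vy]]] := lipfree_approx v (divr_gt0 e0 (ltr0Sn R 1)).
have A0 : 0 <= \sum_(i < n) `|a i| by exact: sumr_ge0.
set A := \sum_(i < n) `|a i| in A0.
(* Moving each [y i] by less than this costs at most [A * (e / 2 / (A + 1)) <= e / 2] in total; the
   other half of [e] went to approximating [v]. *)
have c0 : 0 < e / 2 / (A + 1) by rewrite !divr_gt0// ltr_wpDl.
have [x xy] : {x : 'I_n -> M & forall i, mdist (y i) (f (x i)) < e / 2 / (A + 1)}.
  apply: (@choice _ _ (fun i z => mdist (y i) (f z) < _)) => i.
  by have /closure_mdistP/(_ _ c0)[_ [z _ <-] yz] := df (y i); exists z.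
exists (g (\sum_(i < n) a i *: free_delta (x i))); first exact: imageT.
rewrite is_lipfree_map_sum.
rewrite -(subrKA (\sum_(i < n) a i *: free_delta (y i))).
rewrite (le_lt_trans (ler_normD _ _))// [ltRHS]splitr ltr_leD//.
rewrite -sumrB (le_trans (ler_norm_sum _ _ _))//.
apply: (@le_trans _ _ (\sum_(i < n) `|a i| * (e / 2 / (A + 1)))).
  apply: ler_sum => i _; rewrite -scalerBr normrZ ler_wpM2l//.
  by rewrite (le_trans (free_delta_le _ _ _))// ltW.
by rewrite -mulr_suml mulrCA ger_pMr ?divr_gt0// ler_pdivrMr ?mul1r ?lerDl// ltr_wpDl.
Qed.

Lemma dense_range_lipfree_mapV : f oM = oN -> dense (range g) -> dense (range f).
Proof.
move=> f0 /dense_closureP dg; apply/dense_closureP => y.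
apply: contrapT => /closure_mdistP nfy.
have [r r0 fr] : exists2 r, 0 < r & forall x, r <= mdist y (f x).
  apply: contrapT => nr; apply: nfy => e e0; apply: contrapT => ne; apply: nr.
  exists e => // x; rewrite leNgt; apply/negP => yx; apply: ne.
  by exists (f x).
have tf x : tent y r (f x) = 0 by apply/max_idPl; rewrite subr_le0.
have t_lip0 : tent y r \in lip0_pred oN.
  (* The tent vanishes at [oN] because [oN] is [f oM], a point of the range of [f]. *)
  by rewrite inE; split; [rewrite -f0|exists 1; exact: tent_lipschitz].
pose phi : lip0 oN := Lip0 t_lip0.
have phi1 : `|phi| <= 1 by exact/best_lipschitz_constant_le/tent_lipschitz.
(* No [g u] is closer than [r] to the evaluation at [y]: their difference takes the value [r] on
   [phi], whose norm is at most 1. *)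
have /closure_normP/(_ r r0)[_ [u _ <-]] := dg (free_delta y).
apply/negP; rewrite -leNgt.
have := dual_le_norm (val (free_delta y - g u)) phi.
rewrite -[val _ phi]/(tent y r y - val (g u) phi).
rewrite is_lipfree_map_annihilated// subr0 /tent mdistxx subr0 max_r ?(ltW r0)//.
rewrite (ger0_norm (ltW r0)) => /le_trans; apply.
by rewrite closed_span_normE ler_piMr.
Qed.

End lipfree_map_range.

Theorem proposition2p1 (R : realType) (M N : metricType R) (oM : M) (oN : N)
    (f : M -> N) (f_lip : lipschitz_map f) (f0 : f oM = oN) :
  dense (range (lipfree_map f_lip f0)) <-> dense (range f).
Proof.
have gf := lipfree_mapP f_lip f0.
by split; [exact: dense_range_lipfree_mapV gf f0|exact: dense_range_lipfree_map gf].
Qed.
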